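(* Let $s$ be a natural number and let $n>1$ be an integer. Then the $n$-th $s$-peri-Catalan number $P^s_n$ satisfies $$ P^s_n=3\sum_{k=1}^{n-1}\bigg\{\sum_{j=1}^{q^k_{1}-1}(-1)^{\epsilon^k_{0}+j}\,P^s_{r^k_{-1}-j r^k_{0}}\,P^s_{r^k_{0}}+\sum_{i=1}^{L_k}\ \sum_{j=0}^{q^k_{i+1}-1}(-1)^{\epsilon^k_{i}+j}\,P^s_{r^k_{i-1}-j r^k_{i}}\,P^s_{r^k_{i}}\bigg\}, $$ where, for each $1\le k\le n-1$, the numbers $r^k_l$, $q^k_l$, $L_k$, $\epsilon^k_l$ are the Euclidean Algorithm data of the pair $(n,k)$.
   Context: Quasigroup words. A (basic) quasigroup word over an alphabet of $s$ letters is a formal expression built from the letters using the three binary operation symbols $\cdot$, $/$, $\backslash$ (each letter is a word; if $u,v$ are words then so are $u\cdot v$, $u/v$, $u\backslash v$; distinct expressions are distinct words). Its length is the number of occurrences of letters. The quasigroup identities are: (SL) $x\cdot(x\backslash y)=y$; (SR) $(y/x)\cdot x=y$; (IL) $x\backslash(x\cdot y)=y$; (IR) $(y\cdot x)/x=y$; (DL) $x/(y\backslash x)=y$; (DR) $(x/y)\backslash x=y$. A word is reduced if it cannot be reduced further via these identities, i.e. no subword has the form of the left-hand side of one of these six identities with words substituted for $x$ and $y$. Peri-Catalan numbers. $P^s_n$ is the number of reduced basic quasigroup words of length $n$ over an alphabet of $s$ letters (so $P^s_0=0$). Euclidean Algorithm data. For $1<n$ and $1\le k\le n-1$ put $r^k_{-1}=n$,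 $r^k_0=k$, and let $q^k_l$, $r^k_l$ be the successive quotients and remainders in the Euclidean Algorithm: $r^k_{l-2}=q^k_l r^k_{l-1}+r^k_l$ with $0\le r^k_l<r^k_{l-1}$ for $1\le l\le L_k+1$, where $L_k\ge 0$ is determined by $r^k_{L_k+1}=0$ and $r^k_{L_k}=\gcd(n,k)\neq 0$. Put $\epsilon^k_0=1$ and $\epsilon^k_{l+1}=\epsilon^k_l+q^k_{l+1}$. Empty sums are $0$. *)

(* Defs.v *)
From HB Require Import structures.
From mathcomp Require Import all_boot all_order all_algebra.

Set Implicit Arguments.
Unset Strict Implicit.
Unset Printing Implicit Defensive.

(** Quasigroup words *)

Inductive qword (s : nat) : Type :=
| Letter of 'I_s
| Mul of qword s & qword s
| RDiv of qword s & qword s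
| LDiv of qword s & qword s.

Declare Scope qword_scope.
Delimit Scope qword_scope with Q.
Notation "u * v" := (Mul u v) : qword_scope.
Notation "u / v" := (RDiv u v) : qword_scope.
Notation "u \ v" := (LDiv u v)
  (at level 40, left associativity) : qword_scope.
Bind Scope qword_scope with qword.

Section WordEquality.
Variable s : nat.

Fixpoint qword_encode (w : qword s) : GenTree.tree 'I_s :=
  match w with
  | Letter a => GenTree.Leaf a
  | Mul u v => GenTree.Node 0 [:: qword_encode u; qword_encode v]
  | RDiv u v => GenTree.Node 1 [:: qword_encode u; qword_encode v]
  | LDiv u v => GenTree.Node 2 [:: qword_encode u; qword_encode v]
  end.

Fixpoint qword_decode (t : GenTree.tree 'I_s) : option (qword s) :=
  match t with
  | GenTree.Leaf a => Some (Letter a)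
  | GenTree.Node m [:: t1; t2] =>
      match qword_decode t1, qword_decode t2 with
      | Some u, Some v =>
          match m with
          | 0 => Some (Mul u v)
          | 1 => Some (RDiv u v)
          | _ => Some (LDiv u v)
          end
      | _, _ => None
      end
  | _ => None
  end.

Lemma qword_encodeK : pcancel qword_encode qword_decode.
Proof. by elim=> //= u -> v ->. Qed.

HB.instance Definition _ := Countable.copy (qword s) (pcan_type qword_encodeK).

End WordEquality.

Fixpoint qlength (s : nat) (w : qword s) : nat :=
  match w with
  | Letter _ => 1
  | Mul u v | RDiv u v | LDiv u v => qlength u + qlength v
  end.

Fixpoint subwords (s : nat) (w : qword s) : seq (qword s) :=
  w :: match w with
       | Letter _ => [::]
       | Mul u v | RDiv u v | LDiv u v => subwords u ++ subwords v
       end.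

Definition is_lhs (s : nat) (w : qword s) : bool :=
  [|| (* SL *) if w is (x * (x' \ y))%Q then x' == x else false,
      (* SR *) if w is ((y / x') * x)%Q then x' == x else false,
      (* IL *) if w is (x \ (x' * y))%Q then x' == x else false,
      (* IR *) if w is ((y * x') / x)%Q then x' == x else false,
      (* DL *) if w is (x / (y \ x'))%Q then x' == x else false
    | (* DR *) if w is ((x' / y) \ x)%Q then x' == x else false].

Lemma is_lhsP (s : nat) (w : qword s) :
  reflect (exists x y : qword s,
             [\/ w = (x * (x \ y))%Q, w = ((y / x) * x)%Q,
                 w = (x \ (x * y))%Q |
                 [\/ w = ((y * x) / x)%Q, w = (x / (y \ x))%Q |
                     w = ((x / y) \ x)%Q]])
          (is_lhs w).
Proof.
apply: (iffP idP); rewrite /is_lhs; last first.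
  by case=> x [y [->|->|->|[->|->|->]]]; rewrite eqxx ?orbT.
case: w => [a|u v|u v|u v] //=; rewrite ?orbF.
- case/orP.
    by case: v => // x y /eqP->; exists u, y; constructor 1.
  by case: u => // y x /eqP->; exists v, y; constructor 2.
- case/orP.
    by case: u => // y x /eqP->; exists v, y; constructor 4; constructor 1.
  by case: v => // y x /eqP->; exists u, y; constructor 4; constructor 2.
- case/orP.
    by case: v => // x y /eqP->; exists u, y; constructor 3.
  by case: u => // x y /eqP->; exists v, y; constructor 4; constructor 3.
Qed.

Definition reduced (s : nat) (w : qword s) : bool :=
  ~~ has (@is_lhs s) (subwords w).

(** Peri-Catalan numbers *)

Definition qword_of_length (s n : nat) := {w : qword s | qlength w == n}.

Section WordsOfLengthFinite.
Variable s : nat.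

Fixpoint qwords_upto_depth (m : nat) : seq (qword s) :=
  if m is m'.+1 then
    let ws := qwords_upto_depth m' in
    [seq Letter a | a <- enum 'I_s] ++
    [seq Mul u v | u <- ws, v <- ws] ++
    [seq RDiv u v | u <- ws, v <- ws] ++
    [seq LDiv u v | u <- ws, v <- ws]
  else [::].

Lemma qlength_gt0 (w : qword s) : 0 < qlength w.
Proof. by elim: w => //= u Hu v Hv; rewrite addn_gt0 Hu. Qed.

Lemma mem_qwords_upto_depth (m : nat) (w : qword s) :
  qlength w <= m -> w \in qwords_upto_depth m.
Proof.
elim: m w => [|m IHm] w; first by rewrite leqNgt qlength_gt0.
have sub u v : qlength u + qlength v <= m.+1 ->
    u \in qwords_upto_depth m /\ v \in qwords_upto_depth m.
  move=> le_uv; split; apply: IHm; rewrite -ltnS; apply: leq_trans le_uv.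
    by rewrite -addn1 leq_add2l qlength_gt0.
  by rewrite -add1n leq_add2r qlength_gt0.
case: w => [a _|u v /sub[Hu Hv]|u v /sub[Hu Hv]|u v /sub[Hu Hv]] /=.
- by rewrite mem_cat map_f ?mem_enum.
- by rewrite !mem_cat (allpairs_f (@Mul s) Hu Hv) ?orbT.
- by rewrite !mem_cat (allpairs_f (@RDiv s) Hu Hv) ?orbT.
- by rewrite !mem_cat (allpairs_f (@LDiv s) Hu Hv) ?orbT.
Qed.

Definition qword_of_length_enum (n : nat) : seq (qword_of_length s n) :=
  undup (pmap insub (qwords_upto_depth n)).

Lemma qword_of_length_enumP (n : nat) :
  Finite.axiom (qword_of_length_enum n).
Proof.
apply: Finite.uniq_enumP => [|w]; first exact: undup_uniq.
rewrite mem_undup mem_pmap_sub; apply: mem_qwords_upto_depth.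
by rewrite (eqP (valP w)).
Qed.

HB.instance Definition _ (n : nat) := Countable.on (qword_of_length s n).
HB.instance Definition _ (n : nat) :=
  isFinite.Build (qword_of_length s n) (@qword_of_length_enumP n).

End WordsOfLengthFinite.

Definition periCatalan (s n : nat) : nat :=
  #|[set w : qword_of_length s n | reduced (val w)]|.

(** Euclidean Algorithm data of a pair [(n, k)] *)

(* The indices of the remainders are shifted by one: [eucl_rem n k l] is
   r^k_(l-1), so that it starts with r^k_(-1) = n and r^k_0 = k. *)
Fixpoint eucl_rem (n k l : nat) : nat :=
  match l with
  | 0 => n
  | 1 => k
  | (l''.+1 as l').+1 => eucl_rem n k l'' %% eucl_rem n k l'
  end.

(* q^k_l, for l >= 1 *)
Definition eucl_quo (n k l : nat) : nat :=
  eucl_rem n k l.-1 %/ eucl_rem n k l.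

(* L_k, the least l with r^k_(l+1) = 0; for k > 0 it is smaller than k. *)
Definition eucl_len (n k : nat) : nat :=
  find (fun l => eucl_rem n k l.+2 == 0) (iota 0 k).

Fixpoint eucl_eps (n k l : nat) : nat :=
  if l is l'.+1 then eucl_eps n k l' + eucl_quo n k l'.+1 else 1.

Lemma eucl_len_aux (n k l : nat) :
  (forall i, i < l -> eucl_rem n k i.+2 != 0) -> 0 < k ->
  eucl_rem n k l.+1 + l <= k.
Proof.
move=> Hl k_gt0; elim: l Hl => [|l IHl] Hl; first by rewrite addn0.
have r_gt0 : 0 < eucl_rem n k l.+1.
  case: l Hl {IHl} => [|l] Hl //; rewrite lt0n; apply: Hl.
  exact: ltnW.
apply: leq_trans (IHl _); last by move=> i lt_il; apply: Hl; apply: ltnW.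
by rewrite addnS ltn_add2r ltn_mod.
Qed.

Lemma eucl_lenP (n k : nat) :
  0 < k ->
  [/\ eucl_rem n k (eucl_len n k).+2 = 0,
      eucl_rem n k (eucl_len n k).+1 = gcdn n k &
      forall l, 0 < l <= (eucl_len n k).+1 ->
        eucl_rem n k l.-1
          = eucl_quo n k l * eucl_rem n k l + eucl_rem n k l.+1
        /\ eucl_rem n k l.+1 < eucl_rem n k l].
Proof.
move=> k_gt0; set L := eucl_len n k.
have before i : i < L -> eucl_rem n k i.+2 != 0.
  move=> lt_iL; have := before_find 0 lt_iL.
  have lt_ik : i < k.
    by apply: leq_trans lt_iL _; rewrite -[leqRHS](size_iota 0) find_size.
  by rewrite nth_iota // add0n => ->.
have gt0 l : l <= L -> 0 < eucl_rem n k l.+1.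
  by case: l => // l /before; rewrite -lt0n.
have hasL : has (fun l => eucl_rem n k l.+2 == 0) (iota 0 k).
  apply: contraT => no; have eqL : L = k.
    by rewrite /L /eucl_len hasNfind // size_iota.
  have := eucl_len_aux before k_gt0; rewrite eqL -[leqRHS]add0n leq_add2r.
  by rewrite leqNgt gt0 // eqL.
have endL : eucl_rem n k L.+2 = 0.
  have := nth_find 0 hasL; rewrite -/(eucl_len n k) -/L nth_iota ?add0n.
    by move/eqP.
  by rewrite -[ltnRHS](size_iota 0 k) -has_find.
have gcdE l : gcdn (eucl_rem n k l) (eucl_rem n k l.+1) = gcdn n k.
  by elim: l => //= l <-; rewrite gcdn_modr gcdnC.
split=> //; first by rewrite -(gcdE L.+1) endL gcdn0.
by case=> // l /andP[_ lel]; split; [exact: divn_eq | rewrite ltn_mod gt0].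
Qed.

(* Main.v *)
Require Import Defs.
From mathcomp Require Import all_boot all_order all_algebra.
From mathcomp Require Import zify ring.

Import Order.TTheory GRing.Theory Num.Theory.

(** A word of length [n > 1] is [u * v], [u / v] or [u \ v] for a unique pair
    [(u, v)], and it is reduced exactly when [u] and [v] are reduced and the word
    itself is not the left-hand side of an identity.  So [P_n] is a sum, over the
    three operations and over the length [k] of [v], of numbers of reduced pairs.

    Let [N f a b] count the pairs [(u, v)] of reduced words of lengths [a], [b]
    with [f u v] reduced, where [f] is one of the six parastrophes: the three
    operations and their opposites.  The six identities say that [f u v] is a
    left-hand side exactly when [u = g y v] or [v = h y u] for some [y], where [g]
    and [h] are again parastrophes ([parastrophe_lhs]).  The first case forces [u]
    to be longer than [v] and the second forces it to be shorter, so they exclude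
    each other, and the lengths of the pairs [(y, v)] and [(y, u)] are known:
      [N f a b + N g (a - b) b + N h (b - a) a = P_a P_b]
    with truncated subtraction ([nb_reduced_pairs_rec]).

    This recursion has the same shape for all six parastrophes, so by induction
    [N f] does not depend on [f].  Taking opposites, the common value [M] is
    symmetric.  Hence [P_n] is three times the sum of the [M (n - k) k]
    ([periCatalan_sum]), and [M (a + b) b = P_(a + b) P_b - M a b].  Unrolling the
    last identity, [M a b] becomes an alternating sum of [a %/ b] products
    followed by [M b (a %% b)] with a sign: one division step of the Euclidean
    Algorithm ([nb_reduced_products_divn]).  The process ends with [M d 0 = 0],
    where [d] is the greatest common divisor, and the exponent [eucl_eps] records
    the parity of the number of subtractions made ([euclid_tail]). *)

(** * Parastrophes *)

Section ReducedPairs.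

Set Implicit Arguments.
Unset Strict Implicit.

Variable s : nat.
Implicit Types (u v w y : qword s) (f g h : qword s -> qword s -> qword s).
Local Notation P := (periCatalan s).

Definition opposite f u v := f v u.

Variant parastrophe : (qword s -> qword s -> qword s) -> Prop :=
| ParaMul : parastrophe (@Mul s)
| ParaRDiv : parastrophe (@RDiv s)
| ParaLDiv : parastrophe (@LDiv s)
| ParaMulOp : parastrophe (opposite (@Mul s))
| ParaRDivOp : parastrophe (opposite (@RDiv s))
| ParaLDivOp : parastrophe (opposite (@LDiv s)).

Lemma parastrophe_inj f u v u' v' :
  parastrophe f -> f u v = f u' v' -> u = u' /\ v = v'.
Proof. by case=> [] []. Qed.

Lemma parastrophe_length f u v :
  parastrophe f -> qlength (f u v) = (qlength u + qlength v)%N.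
Proof. by case; rewrite //= addnC. Qed.

Lemma parastrophe_reduced f u v :
  parastrophe f ->
  reduced (f u v) = [&& reduced u, reduced v & ~~ is_lhs (f u v)].
Proof.
by case; rewrite /reduced /opposite [in LHS]/= negb_or has_cat negb_or andbC
  -?andbA // andbCA.
Qed.

Lemma parastrophe_reduced_right f u v :
  parastrophe f -> reduced (f u v) -> reduced v.
Proof. by move=> para_f; rewrite parastrophe_reduced // => /and3P[]. Qed.

(** Each operation is the middle symbol of two of the six left-hand sides, one
    with a compound left factor and one with a compound right factor.  Passing to
    the opposite of [f] exchanges [g] and [h]; this is why the opposites have to
    be allowed, since for instance [u * v] with [v = u \ y] calls for
    [h y u = u \ y]. *)
Lemma parastrophe_lhs f :
  parastrophe f ->
  exists g h, [/\ parastrophe g, parastrophe h &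
    forall u v, is_lhs (f u v) <->
      (exists y, u = g y v) \/ (exists y, v = h y u)].
Proof.
have lhsE (e g h : qword s -> qword s -> qword s) :
    (forall u v, is_lhs (e u v) <->
      (exists y, u = g y v) \/ (exists y, v = h y u)) ->
    forall u v, is_lhs (opposite e u v) <->
      (exists y, u = h y v) \/ (exists y, v = g y u).
  by move=> eP u v; rewrite /opposite eP; split=> -[]; auto.
have MulE u v : is_lhs (Mul u v) <->
    (exists y, u = RDiv y v) \/ (exists y, v = opposite (@LDiv s) y u).
  split=> [/is_lhsP[x [y]]|[[y ->]|[y ->]]].
  - by case=> [[-> ->]|[-> ->]|//|[]//]; [right|left]; exists y.
  - by apply/is_lhsP; exists v, y; constructor 2.
  - by apply/is_lhsP; exists u, y; constructor 1.
have RDivE u v : is_lhs (RDiv u v) <->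
    (exists y, u = Mul y v) \/ (exists y, v = LDiv y u).
  split=> [/is_lhsP[x [y]]|[[y ->]|[y ->]]].
  - by case=> // -[[-> ->]|[-> ->]|//]; [left|right]; exists y.
  - by apply/is_lhsP; exists v, y; constructor 4; constructor 1.
  - by apply/is_lhsP; exists u, y; constructor 4; constructor 2.
have LDivE u v : is_lhs (LDiv u v) <->
    (exists y, u = opposite (@RDiv s) y v) \/
    (exists y, v = opposite (@Mul s) y u).
  split=> [/is_lhsP[x [y]]|[[y ->]|[y ->]]].
  - by case=> [//|//|[-> ->]|[//|//|[-> ->]]]; [right|left]; exists y.
  - by apply/is_lhsP; exists v, y; constructor 4; constructor 3.
  - by apply/is_lhsP; exists u, y; constructor 3.
case.
- by exists (@RDiv s), (opposite (@LDiv s)); split=> //; constructor.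
- by exists (@Mul s), (@LDiv s); split=> //; constructor.
- by exists (opposite (@RDiv s)), (opposite (@Mul s)); split=> //; constructor.
- by exists (opposite (@LDiv s)), (@RDiv s); split; [constructor..|exact: lhsE].
- by exists (@LDiv s), (@Mul s); split; [constructor..|exact: lhsE].
- by exists (opposite (@Mul s)), (opposite (@RDiv s)); split;
    [constructor..|exact: lhsE].
Qed.

(** * Counting reduced pairs *)

(** With the projection given this type, the finite type of words of length [n]
    is found rather than the sigma type that it unfolds to. *)
Definition word_of_length n (x : qword_of_length s n) : qword s := val x.

Definition reduced_words n : seq (qword s) :=
  [seq word_of_length x
    | x <- enum [set x : qword_of_length s n | reduced (val x)]].

Lemma reduced_words_uniq n : uniq (reduced_words n).
Proof. by rewrite map_inj_uniq ?enum_uniq // => x y /val_inj. Qed.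

Lemma mem_reduced_words n w :
  (w \in reduced_words n) = (qlength w == n) && reduced w.
Proof.
apply/mapP/andP=> [[x]|[len_w red_w]].
  by rewrite mem_enum inE => red_x ->; split=> //; exact: (valP x).
by exists (exist _ w len_w : qword_of_length s n); rewrite ?mem_enum ?inE.
Qed.

Lemma size_reduced_words n : size (reduced_words n) = P n.
Proof. by rewrite size_map -cardE. Qed.

(** Reducedness of [f u v] is expressed through [is_lhs] only, so that the
    complement of these pairs among all pairs of reduced words is a filter. *)
Definition reduced_pairs f a b : seq (qword s * qword s) :=
  [seq p <- [seq (u, v) | u <- reduced_words a, v <- reduced_words b]
    | ~~ is_lhs (f p.1 p.2)].

Definition nb_reduced_pairs f a b := size (reduced_pairs f a b).
Local Notation N := nb_reduced_pairs.

Lemma word_pairs_uniq a b :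
  uniq [seq (u, v) | u <- reduced_words a, v <- reduced_words b].
Proof.
by apply: allpairs_uniq; try exact: reduced_words_uniq; move=> [? ?] [? ?].
Qed.

Lemma mem_word_pairs a b u v :
  ((u, v) \in [seq (u, v) | u <- reduced_words a, v <- reduced_words b]) =
  ((qlength u == a) && reduced u) && ((qlength v == b) && reduced v).
Proof.
rewrite -!mem_reduced_words.
apply/allpairsP/andP => [[[x y] /= [? ? [-> ->]]]|[? ?]] //.
by exists (u, v).
Qed.

Lemma mem_reduced_pairs f a b u v :
  parastrophe f ->
  ((u, v) \in reduced_pairs f a b) =
  [&& qlength u == a, qlength v == b & reduced (f u v)].
Proof.
move=> para_f; rewrite mem_filter mem_word_pairs parastrophe_reduced //=.
by rewrite andbC -!andbA; congr andb; rewrite andbCA.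
Qed.

Lemma nb_reduced_pairs0l f b : N f 0 b = 0%N.
Proof.
apply/eqP; rewrite size_eq0; apply/eqP.
case E: (reduced_pairs f 0 b) => [|[u v] r] //.
have: (u, v) \in reduced_pairs f 0 b by rewrite E mem_head.
by rewrite mem_filter mem_word_pairs eqn0Ngt qlength_gt0 !andbF.
Qed.

Lemma nb_reduced_pairs0r f a : N f a 0 = 0%N.
Proof.
apply/eqP; rewrite size_eq0; apply/eqP.
case E: (reduced_pairs f a 0) => [|[u v] r] //.
have: (u, v) \in reduced_pairs f a 0 by rewrite E mem_head.
by rewrite mem_filter mem_word_pairs (eqn0Ngt (qlength v)) qlength_gt0 !andbF.
Qed.

(** Among the [P a * P b] pairs of reduced words, those with [f u v] not reduced
    are the [(g y v, v)] and the [(u, h y u)].  Cancellation makes [y] unique, and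
    comparing lengths shows that no pair is of both forms.  When [a <= b] the
    first family is empty, in agreement with [N g 0 b = 0]. *)
Lemma nb_reduced_pairs_rec f g h a b :
  parastrophe f -> parastrophe g -> parastrophe h ->
  (forall u v, is_lhs (f u v) <->
      (exists y, u = g y v) \/ (exists y, v = h y u)) ->
  (N f a b + (N g (a - b) b + N h (b - a) a))%N = (P a * P b)%N.
Proof.
move=> para_f para_g para_h lhsE.
set W := [seq (u, v) | u <- reduced_words a, v <- reduced_words b].
have sizeW : size W = (P a * P b)%N by rewrite size_allpairs !size_reduced_words.
rewrite -sizeW -(count_predC (fun p => is_lhs (f p.1 p.2))) addnC -!size_filter.
congr addn.
pose left := [seq (g p.1 p.2, p.2) | p <- reduced_pairs g (a - b) b].
pose right := [seq (p.2, h p.1 p.2) | p <- reduced_pairs h (b - a) a].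
have <- : size left = N g (a - b) b by rewrite size_map.
have <- : size right = N h (b - a) a by rewrite size_map.
rewrite -size_cat; apply/perm_size/uniq_perm.
- rewrite cat_uniq !map_inj_in_uniq ?filter_uniq ?word_pairs_uniq //=.
  + rewrite andbT; apply/hasPn=> -[u v] /mapP[[y x]].
    rewrite mem_reduced_pairs // => /and3P[_ /eqP/= lx _] [-> ->].
    apply/mapP=> -[[y' x']]; rewrite mem_reduced_pairs //.
    move=> /and3P[_ _ _] [/= eq_x eq_x'].
    have := congr1 (@qlength s) eq_x; have := congr1 (@qlength s) eq_x'.
    rewrite !parastrophe_length //.
    have := qlength_gt0 y; have := qlength_gt0 y'; lia.
  + move=> [y x] [y' x'] _ _ [/= eq_x eq_h]; move: eq_h; rewrite eq_x.
    by case/(parastrophe_inj para_h) => ->.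
  + move=> [y x] [y' x'] _ _ [/= eq_h eq_x]; move: eq_h; rewrite eq_x.
    by case/(parastrophe_inj para_g) => ->.
- by rewrite filter_uniq ?word_pairs_uniq.
move=> [u v]; rewrite mem_cat mem_filter mem_word_pairs [X in X && _]/=.
apply/idP/idP=> [/orP[]|/andP[/lhsE]].
- case/mapP=> -[y x]; rewrite mem_reduced_pairs //=.
  case/and3P=> /eqP ly /eqP lx red_g [-> ->].
  rewrite (parastrophe_reduced_right para_g red_g) red_g parastrophe_length //.
  rewrite !andbT; apply/andP; split.
    by apply/lhsE; left; exists y.
  by have := qlength_gt0 y; lia.
- case/mapP=> -[y x]; rewrite mem_reduced_pairs //=.
  case/and3P=> /eqP ly /eqP lx red_h [-> ->].
  rewrite (parastrophe_reduced_right para_h red_h) red_h parastrophe_length //.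
  rewrite andbT; apply/andP; split.
    by apply/lhsE; right; exists y.
  by have := qlength_gt0 y; lia.
- case=> -[y ->] /andP[/andP[/eqP lu ru] /andP[/eqP lv rv]]; apply/orP.
    left; apply/mapP; exists (y, v) => //; rewrite mem_reduced_pairs //=.
    move: lu ru; rewrite parastrophe_length // => <- ->.
    by rewrite lv addnK !eqxx.
  right; apply/mapP; exists (y, u) => //; rewrite mem_reduced_pairs //=.
  move: lv rv; rewrite parastrophe_length // => <- ->.
  by rewrite lu addnK !eqxx.
Qed.

(** The recursion determines [N f] by induction on [a + b], without reference to
    which parastrophes [g] and [h] appear in it. *)
Lemma nb_reduced_pairs_parastrophe f g a b :
  parastrophe f -> parastrophe g -> N f a b = N g a b.
Proof.
have [m] := ubnP (a + b); elim: m a b f g => // m IHm [|a] b f g.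
  by rewrite !nb_reduced_pairs0l.
case: b => [|b]; first by rewrite !nb_reduced_pairs0r.
move=> lt_m para_f para_g.
have [f1 [f2 [para_f1 para_f2 /nb_reduced_pairs_rec recf]]] :=
  parastrophe_lhs para_f.
have [g1 [g2 [para_g1 para_g2 /nb_reduced_pairs_rec recg]]] :=
  parastrophe_lhs para_g.
have := recf a.+1 b.+1 para_f para_f1 para_f2.
rewrite -(recg a.+1 b.+1) // (IHm (a.+1 - b.+1) _ f1 g1) //; last lia.
by rewrite (IHm (b.+1 - a.+1) _ f2 g2) //; [lia | lia].
Qed.

Lemma nb_reduced_pairs_opposite f a b : N (opposite f) a b = N f b a.
Proof.
rewrite -[RHS](size_map (fun p => (p.2, p.1))); apply/perm_size/uniq_perm.
- by rewrite filter_uniq ?word_pairs_uniq.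
- rewrite map_inj_uniq ?filter_uniq ?word_pairs_uniq //.
  by move=> [? ?] [? ?] /= [-> ->].
move=> [u v]; rewrite mem_filter mem_word_pairs /=.
apply/and3P/mapP => [[red lu lv]|[[u' v']]].
  exists (v, u) => //; rewrite mem_filter mem_word_pairs /= lu lv !andbT.
  exact: red.
by rewrite mem_filter mem_word_pairs => /and3P[? ? ?] [-> ->].
Qed.

Definition nb_reduced_products := N (@Mul s).
Local Notation M := nb_reduced_products.

Lemma nb_reduced_productsC a b : M a b = M b a.
Proof.
rewrite /M -(nb_reduced_pairs_opposite (@Mul s) a b).
exact: (nb_reduced_pairs_parastrophe _ _ ParaMul ParaMulOp).
Qed.

(** The second correction term of the recursion vanishes, as the left factor is
    at least as long as the right one. *)
Lemma nb_reduced_products_addl a b :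
  (M (a + b) b + M a b)%N = (P (a + b) * P b)%N.
Proof.
have [g [h [para_g para_h lhsE]]] := parastrophe_lhs ParaMul.
rewrite -(nb_reduced_pairs_rec (a + b) b ParaMul para_g para_h lhsE).
rewrite addnK (_ : b - (a + b) = 0)%N; last lia.
rewrite nb_reduced_pairs0l addn0.
by rewrite (nb_reduced_pairs_parastrophe _ _ para_g ParaMul).
Qed.

(** * Reduced words by their outermost operation *)

Definition reduced_values f n : seq (qword s) :=
  [seq f p.1 p.2 | k <- index_iota 1 n, p <- reduced_pairs f (n - k) k].

Lemma size_reduced_values f n :
  parastrophe f -> size (reduced_values f n) = (\sum_(1 <= k < n) M (n - k) k)%N.
Proof.
move=> para_f; rewrite size_allpairs_dep sumnE big_map.
apply: eq_bigr => k _.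
exact: (nb_reduced_pairs_parastrophe _ _ para_f ParaMul).
Qed.

Lemma mem_reduced_values f n w :
  parastrophe f ->
  reflect (exists u v, w = f u v /\ w \in reduced_words n)
          (w \in reduced_values f n).
Proof.
move=> para_f; rewrite mem_reduced_words.
apply: (iffP allpairsPdep) => [[k [[u v]]]|[u [v [-> /andP[/eqP <- red]]]]].
  rewrite mem_index_iota mem_reduced_pairs // => -[hk /and3P[lu lv red] ->].
  exists u, v; rewrite /= red parastrophe_length //; split=> //; lia.
exists (qlength v), (u, v); rewrite mem_reduced_pairs // red mem_index_iota.
rewrite parastrophe_length // addnK !eqxx; split=> //.
have := qlength_gt0 u; have := qlength_gt0 v; lia.
Qed.

Lemma reduced_values_uniq f n : parastrophe f -> uniq (reduced_values f n).
Proof.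
move=> para_f; apply: allpairs_uniq_dep; first exact: iota_uniq.
  by move=> k _; rewrite filter_uniq ?word_pairs_uniq.
move=> [k p] [k' p'] /allpairsPdep[k1 [[u v] [_ mem1 ->]]].
move=> /allpairsPdep[k2 [[u' v'] [_ mem2 ->]]] /=.
move=> /(parastrophe_inj para_f)[eu ev].
move: mem1 mem2; rewrite !mem_reduced_pairs // eu ev.
by move=> /and3P[_ /eqP <- _] /and3P[_ /eqP <- _].
Qed.

Lemma periCatalan_sum n :
  (1 < n)%N -> P n = (3 * \sum_(1 <= k < n) M (n - k) k)%N.
Proof.
move=> n_gt1; rewrite -size_reduced_words.
rewrite (_ : 3 * _ = size (reduced_values (@Mul s) n ++
    reduced_values (@RDiv s) n ++ reduced_values (@LDiv s) n))%N; last first.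
  by rewrite !size_cat !size_reduced_values ?mulSn ?mul0n ?addn0 //; constructor.
apply/perm_size/uniq_perm; first exact: reduced_words_uniq.
  rewrite !cat_uniq !reduced_values_uniq //=; try constructor.
  rewrite andbT; apply/andP; split; apply/hasPn=> w.
    rewrite mem_cat => /orP[] /mem_reduced_values[|u [v [-> _]]];
      try constructor;
      by apply/mem_reduced_values=> [|[? [? []]]]; first constructor.
  case/mem_reduced_values=> [|u [v [-> _]]]; first constructor.
  by apply/mem_reduced_values=> [|[? [? []]]]; first constructor.
move=> w; rewrite !mem_cat; apply/idP/or3P => [mem_w|].
  case: w mem_w => [a|u v|u v|u v] mem_w.
  - by move: mem_w n_gt1; rewrite mem_reduced_words => /andP[/eqP <-].
  - by constructor 1; apply/mem_reduced_values; [constructor|exists u, v].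
  - by constructor 2; apply/mem_reduced_values; [constructor|exists u, v].
  - by constructor 3; apply/mem_reduced_values; [constructor|exists u, v].
by case=> /mem_reduced_values[|? [? []]] //; constructor.
Qed.

(** * Unrolling along the Euclidean Algorithm *)

Local Open Scope ring_scope.

(** Each subtraction of [b] from the left length yields one product and a change
    of sign; after [a %/ b] of them the remainder is left. *)
Lemma nb_reduced_products_divn a b :
  (M a b)%:Z =
  \sum_(0 <= j < (a %/ b)%N) (-1) ^+ j * (P (a - j * b))%:Z * (P b)%:Z
  + (-1) ^+ (a %/ b) * (M (a %% b) b)%:Z.
Proof.
(* The remainder varies: a step of the induction adds [b] to it. *)
have unroll q r : (M (q * b + r) b)%:Z =
    \sum_(0 <= j < q) (-1) ^+ j * (P (q * b + r - j * b))%:Z * (P b)%:Z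
    + (-1) ^+ q * (M r b)%:Z; last by rewrite {1}(divn_eq a b) unroll -divn_eq.
elim: q r => [|q IHq] r; first by rewrite big_geq // add0r mul1r.
rewrite mulSnr -addnA IHq big_nat_recr //= addnA -addrA; congr (_ + _).
rewrite (_ : q * b + b + r - q * b = r + b)%N; last lia.
have := nb_reduced_products_addl r b; rewrite addnC (addnC b) exprS.
by move/(congr1 Posz); rewrite !PoszD PoszM -mulrA => <-; ring.
Qed.

(** Downward induction on [i].  At [i = L_k + 1] the sum is empty and the next
    remainder is 0.  Below, division gives the [i]-th inner sum and, by symmetry
    of [M], the [M] of the next pair of remainders, while the quotient is added to
    the exponent of the sign. *)
Lemma euclid_tail n k i :
  (i <= (eucl_len n k).+1)%N -> (0 < k)%N ->
  \sum_(i <= l < (eucl_len n k).+1)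
    \sum_(0 <= j < eucl_quo n k l.+1)
      (-1) ^+ (eucl_eps n k l + j)
      * (P (eucl_rem n k l - j * eucl_rem n k l.+1))%:Z
      * (P (eucl_rem n k l.+1))%:Z
  = (-1) ^+ eucl_eps n k i * (M (eucl_rem n k i) (eucl_rem n k i.+1))%:Z.
Proof.
move=> le_i k_gt0; rewrite -(subKn le_i).
elim: (_ - i)%N (leq_subr i (eucl_len n k).+1) => [|d IHd] le_d.
  have [endL _ _] := eucl_lenP n k_gt0.
  by rewrite subn0 big_geq // endL /M nb_reduced_pairs0r mulr0.
set l := (_ - d.+1)%N.
have lS : ((eucl_len n k).+1 - d)%N = l.+1 by rewrite /l; lia.
rewrite big_ltn; last by rewrite /l; lia.
rewrite -lS IHd; last exact: ltnW.
rewrite lS [in RHS]nb_reduced_products_divn mulrDr.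
congr (_ + _).
  by rewrite big_distrr /=; apply: eq_bigr => j _; rewrite exprD !mulrA.
by rewrite mulrA -exprD nb_reduced_productsC.
Qed.

(** The quotient [q_1] comes from dividing [n], not [n - k], by [k], so it is
    [M n k] that gets unrolled.  Since [M (n - k) k = P_n P_k - M n k], the term
    [j = 0], which is [P_n P_k], cancels and all other signs are reversed; hence
    the lower bound [j = 1] and the initial value [eucl_eps n k 0 = 1]. *)
Lemma euclid_sum n k :
  (0 < k)%N -> (k <= n)%N ->
  (M (n - k) k)%:Z =
  \sum_(1 <= j < eucl_quo n k 1)
     (-1) ^+ (eucl_eps n k 0 + j)
     * (P (eucl_rem n k 0 - j * eucl_rem n k 1))%:Z
     * (P (eucl_rem n k 1))%:Z
  + \sum_(1 <= i < (eucl_len n k).+1)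
      \sum_(0 <= j < eucl_quo n k i.+1)
        (-1) ^+ (eucl_eps n k i + j)
        * (P (eucl_rem n k i - j * eucl_rem n k i.+1))%:Z
        * (P (eucl_rem n k i.+1))%:Z.
Proof.
move=> k_gt0 le_kn; rewrite euclid_tail //= nb_reduced_productsC.
have addE := nb_reduced_products_addl (n - k) k.
rewrite subnK // (nb_reduced_productsC (n - k)) in addE.
have divE := nb_reduced_products_divn n k.
rewrite big_ltn ?divn_gt0 // mul0n subn0 expr0 mul1r in divE.
rewrite (eq_bigr (fun j =>
  - ((-1) ^+ j * (P (n - j * k))%:Z * (P k)%:Z))); last first.
  by move=> j _; rewrite exprS; ring.
move/(congr1 Posz): addE; rewrite sumrN exprS PoszD PoszM divE.
move/(canRL (addKr _)) => ->.
by rewrite (nb_reduced_productsC k (n %% k)) /eucl_quo /=; ring.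
Qed.

End ReducedPairs.

Local Open Scope ring_scope.

(* Since eucl_rem n k l is r^k_(l-1), the remainders r^k_(-1), r^k_0, r^k_(i-1)
   and r^k_i are eucl_rem n k 0, eucl_rem n k 1, eucl_rem n k i and
   eucl_rem n k i.+1. *)
Theorem theorem4p9 (s n : nat) (hn : (1 < n)%N) :
  (periCatalan s n)%:Z =
  3 * \sum_(1 <= k < n)
    (\sum_(1 <= j < eucl_quo n k 1)
        (-1) ^+ (eucl_eps n k 0 + j)
        * (periCatalan s (eucl_rem n k 0 - j * eucl_rem n k 1))%:Z
        * (periCatalan s (eucl_rem n k 1))%:Z
     + \sum_(1 <= i < (eucl_len n k).+1)
         \sum_(0 <= j < eucl_quo n k i.+1)
           (-1) ^+ (eucl_eps n k i + j)
           * (periCatalan s (eucl_rem n k i - j * eucl_rem n k i.+1))%:Z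
           * (periCatalan s (eucl_rem n k i.+1))%:Z).
Proof.
rewrite periCatalan_sum // PoszM; congr (_ * _); rewrite (raddf_sum Posz).
apply: eq_big_nat => k /andP[k_gt0 lt_kn].
exact: euclid_sum k_gt0 (ltnW lt_kn).
Qed.
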